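(* Let $(X,d_X)$ and $(Y,d_Y)$ be doubling metric spaces, let $\beta\geq 1\geq\alpha>0$, and let $S : X\rightarrow Y$ be a map for which there are constants $c,C>0$ such that \[ c\, d_X(x,y)^\beta \ \leq \ d_Y\big(S(x),S(y)\big) \ \leq \ C\, d_X(x,y)^\alpha \] for all $x,y \in X$ with $d_X(x,y)$ sufficiently small. Let $F\subseteq X$ be non-empty, assume that the set of $\theta\in(0,1)$ with $\dim_\mathrm{A}^{\theta} F=\dim_\mathrm{A} F$ is non-empty, and let \[ \theta_0=\inf\left\{ \theta\in (0,1) : \dim_\mathrm{A}^{\theta} F=\dim_\mathrm{A} F \right\}. \] Then \[ \dim_\mathrm{A} S(F)\geq \frac{\dim_\mathrm{A} F}{\beta-\theta_0\alpha}(1-\theta_0). \] In particular, if $S$ is quasi-Lipschitz and $\dim_\mathrm{A}^{\theta} F=\dim_\mathrm{A} F$ for some $\theta\in(0,1)$, then $\dim_\mathrm{A} S(F)\geq\dim_\mathrm{A} F$.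
   Context: A metric space is doubling if there is a uniform constant $C$ such that any ball may be covered by fewer than $C$ balls of half the radius. A map $S$ is quasi-Lipschitz if $\frac{\log d_X(x,y)}{\log d_Y(S(x),S(y))}\to1$ uniformly as $d_X(x,y)\to0$ (with $x\neq y$). For a subset $E$ of a metric space and $r>0$, $N(E,r)$ denotes the minimal number of balls of radius $r$ required to cover $E$, and $B(x,R)$ is the ball of radius $R$ centred at $x$. The Assouad dimension of $F$ is \[ \dim_{\mathrm A} F = \inf\Big\{\alpha : \exists C>0,\ \exists \rho>0,\ \forall\, 0<r<R\leq\rho,\ \forall x\in F,\ N(B(x,R)\cap F,r)\leq C (R/r)^{\alpha}\Big\}. \] For $\theta\in(0,1)$, the Assouad spectrum of $F$ at $\theta$ is \[ \dim_{\mathrm A}^{\theta} F = \inf\Big\{\alpha : \exists C>0,\ \exists \rho>0,\ \forall\, 0<R\leq\rho,\ \forall x\in F,\ N(B(x,R)\cap F,R^{1/\theta})\leq C \big(R/R^{1/\theta}\big)^{\alpha}\Big\}. \] *)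

(* Defs.v *)
From mathcomp Require Import all_boot all_order all_algebra.
From mathcomp Require Import all_classical all_reals all_analysis.

Set Implicit Arguments.
Unset Strict Implicit.
Unset Printing Implicit Defensive.

Import Order.TTheory GRing.Theory Num.Theory.

Local Open Scope classical_set_scope.
Local Open Scope ring_scope.

(* The centres of the covering balls range over the whole ambient space; the
   value is +oo when no finite cover exists. *)
Definition covering_number (K : realType) (X : metricType K)
    (E : set X) (r : K) : \bar K :=
  ereal_inf [set (size s)%:R%:E | s in
    [set s : seq X | E `<=` \bigcup_(x in [set` s]) ball x r]].

Definition doubling (K : realType) (X : metricType K) : Prop :=
  exists C : K, forall (x : X) (r : K), 0 < r ->
    (covering_number (ball x r) (r / 2) < C%:E)%E.

(* Exponents are real; the infimum is taken in the extended reals, so that it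
   is +oo when no exponent is admissible. *)
Definition assouad_dim (K : realType) (X : metricType K)
    (F : set X) : \bar K :=
  ereal_inf [set a%:E | a in [set a : K |
    exists C rho : K, [/\ 0 < C, 0 < rho &
      forall r R : K, 0 < r -> r < R -> R <= rho -> forall x : X, F x ->
        (covering_number (ball x R `&` F) r <= (C * (R / r) `^ a)%:E)%E]]].

Definition assouad_spectrum (K : realType) (X : metricType K)
    (theta : K) (F : set X) : \bar K :=
  ereal_inf [set a%:E | a in [set a : K |
    exists C rho : K, [/\ 0 < C, 0 < rho &
      forall R : K, 0 < R -> R <= rho -> forall x : X, F x ->
        (covering_number (ball x R `&` F) (R `^ theta^-1)
           <= (C * (R / R `^ theta^-1) `^ a)%:E)%E]]].

Definition attaining_thetas (K : realType) (X : metricType K)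
    (F : set X) : set K :=
  [set theta : K | 0 < theta < 1 /\ assouad_spectrum theta F = assouad_dim F].

Definition locally_bi_holder (K : realType) (X Y : metricType K)
    (alpha beta : K) (S : X -> Y) : Prop :=
  exists c C delta : K, [/\ 0 < c, 0 < C, 0 < delta &
    forall x y : X, mdist x y < delta ->
      c * mdist x y `^ beta <= mdist (S x) (S y) <= C * mdist x y `^ alpha].

(* Since [ln 0 = 0] and [_ / 0 = 0], the quotient is 0 when [S x = S y] (the
   value given by log 0 = -oo) or [mdist (S x) (S y) = 1]; such pairs are thus
   excluded at small distances, as they must be for the quotient to be close
   to 1. *)
Definition quasi_lipschitz (K : realType) (X Y : metricType K)
    (S : X -> Y) : Prop :=
  forall eps : K, 0 < eps -> exists2 delta : K, 0 < delta &
    forall x y : X, x <> y -> mdist x y < delta ->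
      `| ln (mdist x y) / ln (mdist (S x) (S y)) - 1 | < eps.

(* Main.v *)
Require Import Defs.
From mathcomp Require Import all_boot all_order all_algebra.
From mathcomp Require Import all_classical all_reals all_analysis.
From mathcomp Require Import ring lra.

Import Order.TTheory GRing.Theory Num.Theory.

Set Implicit Arguments.
Unset Strict Implicit.
Unset Printing Implicit Defensive.

Local Open Scope classical_set_scope.
Local Open Scope ring_scope.

(** The inequality comes from comparing one ball of [F] with one ball of
    [S @` F], at two scales tied together by [theta].  Take [x] in [F] and
    [R] small.  By the upper Hölder bound [S] sends [B(x, R)] into a ball of
    radius [C R^alpha]; by the lower one, points of [B(x, R)] whose images lie
    in a common ball of radius [(c / 2) R^(beta / theta)] are at distance less
    than [R^(1 / theta)].  So covering the image at the scale
    [R^(beta / theta)] costs at least as much as covering [B(x, R)] at the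
    scale [R^(1 / theta)].  If [a] is an admissible exponent for the Assouad
    dimension of [S @` F], the former number is
    [O(R^(- a (beta / theta - alpha)))], hence
    [a (beta - theta alpha) / (1 - theta)] is an admissible exponent for the
    Assouad spectrum of [F] at [theta].  This is [bi_holder_spectrum_le],
    which rests on [covering_number_transfer].

    At an attaining [theta] the spectrum is the Assouad dimension [d], and for
    real [d] the bound reads
    [theta (a alpha - d) <= a beta - d].  This is affine in [theta], so it
    passes to the infimum [theta0] even when [theta0] is not attaining.

    A quasi-Lipschitz map is locally bi-Hölder with exponents [1 - eps] and
    [1 + eps] for every small [eps] ([quasi_lipschitz_bi_holder]); there
    [theta] stays fixed and [eps] tends to [0], which makes the factor
    [(1 - theta) / (beta - theta alpha)] tend to [1]. *)

(** In a cover of [E'] by balls of radius [r'], points of [E] whose images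
    fall in the same ball have images less than [2 * r'] apart; they
    therefore all lie in the ball of radius [r] about any one of them, so each
    ball of the cover of [E'] can be traded for a single ball in [X]. *)
Lemma covering_number_transfer (K : realType) (X Y : metricType K)
    (S : X -> Y) (E : set X) (E' : set Y) (r r' : K) :
  S @` E `<=` E' ->
  (forall y z, E y -> E z -> mdist (S y) (S z) < 2 * r' -> mdist y z < r) ->
  (covering_number E r <= covering_number E' r')%E.
Proof.
move=> SE sep; apply/ereal_infP => _ [s s_cover <-].
have [[x0 _]|E_empty] := pselect (E !=set0); last first.
  apply: ge_ereal_inf; exists 0%E; last by rewrite lee_fin.
  by exists [::] => // y Ey; case: E_empty; exists y.
(* Balls that miss the image of [E] receive the dummy centre [x0]. *)
have /choice[g gP] : forall w : Y, exists y : X,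
    (exists z, E z /\ ball w r' (S z)) -> E y /\ ball w r' (S y).
  move=> w; have [[z wz]|no] := pselect (exists z, E z /\ ball w r' (S z)).
    by exists z.
  by exists x0.
apply: ge_ereal_inf; exists (size (map g s))%:R%:E; last by rewrite size_map.
exists (map g s) => // z Ez.
have [w /= ws wz] : (\bigcup_(w in [set` s]) ball w r') (S z).
  by apply: s_cover; apply: SE; exists z.
exists (g w); first by apply/mapP; exists w.
have [Egw] := gP w (ex_intro _ z (conj Ez wz)).
move: wz; rewrite !ballEmdist /= => wz wg.
apply: sep => //; apply: le_lt_trans (metric_triangle _ w _) _.
by rewrite metric_sym mulr_natl mulr2n ltrD.
Qed.

(** For an exponent [a] admissible for [S @` F], comparing the scales
    [R^alpha] and [R^(beta / theta)] in the image with [R] and [R^(1 / theta)]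
    in [F] turns [a] into [a (beta - theta alpha) / (1 - theta)].  The factor
    is kept on the left, where it multiplies an extended real: the statement
    then also covers infinite values of either side. *)
Lemma bi_holder_spectrum_le (K : realType) (X Y : metricType K) (S : X -> Y)
    (F : set X) (alpha beta theta : K) :
  0 < alpha <= beta -> 0 < theta < 1 -> locally_bi_holder alpha beta S ->
  (assouad_spectrum theta F * ((1 - theta) / (beta - theta * alpha))%:E
     <= assouad_dim (S @` F))%E.
Proof.
move=> /andP[alpha0 alpha_beta] /andP[theta0 theta1].
move=> [c [C [delta [c0 C0 delta0 S_holder]]]].
have den0 : 0 < beta - theta * alpha by nra.
apply/ereal_infP => _ [a [Ca [rho [Ca0 rho0 a_adm]]] <-].
have num0 : 0 < 1 - theta by lra.
rewrite -[X in (_ * X%:E)%E]invrK lee_pdivrMr ?invr_gt0 ?divr_gt0//.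
rewrite -EFinM invf_div mulrA.
set p := beta / theta - alpha.
have p0 : 0 < p by rewrite subr_gt0 ltr_pdivlMr//; nra.
apply: ereal_inf_lbound.
eexists; last reflexivity.
exists (Ca * (2 * C / c) `^ a).
(* The three bounds on [R] keep [B(x, R)] within the range of the Hölder
   estimates, the image radius [C R^alpha] below [rho], and the covering scale
   of the image below that radius. *)
exists (Num.min (delta / 2) (Num.min ((rho / C) `^ alpha^-1) ((C / c) `^ p^-1))).
split; first by rewrite mulr_gt0// powR_gt0// divr_gt0// mulr_gt0.
  by rewrite !lt_min !powR_gt0 ?divr_gt0.
move=> R R0; rewrite !le_min => /and3P[R_delta R_rho R_c] x Fx.
have Rp : R `^ p <= C / c.
  have -> : C / c = ((C / c) `^ p^-1) `^ p.
    by rewrite -powRrM mulVf ?gt_eqF// powRr1// ltW// divr_gt0.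
  by apply: ge0_ler_powR; rewrite ?nnegrE ?powR_ge0// ltW.
have R_alpha : C * R `^ alpha <= rho.
  rewrite mulrC -ler_pdivlMr//.
  have -> : rho / C = ((rho / C) `^ alpha^-1) `^ alpha.
    by rewrite -powRrM mulVf ?gt_eqF// powRr1// ltW// divr_gt0.
  by apply: ge0_ler_powR; rewrite ?nnegrE ?powR_ge0// ltW.
have R_beta : R `^ (beta / theta) = R `^ alpha * R `^ p.
  by rewrite -powRD ?(gt_eqF R0) ?implybT// addrC subrK.
set r' := c / 2 * R `^ (beta / theta).
have r'0 : 0 < r' by rewrite mulr_gt0 ?divr_gt0 ?powR_gt0.
have r'_lt : r' < C * R `^ alpha.
  have Ra0 : 0 < R `^ alpha by exact: powR_gt0.
  have : c * R `^ p <= C by rewrite mulrC -ler_pdivlMr.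
  rewrite /r' R_beta => cRp; have := powR_gt0 p R0; nra.
have near_x y z : ball x R y -> ball x R z -> mdist y z < delta.
  rewrite !ballEmdist /= => xy xz.
  apply: le_lt_trans (metric_triangle _ x _) _; rewrite metric_sym; lra.
have := a_adm _ _ r'0 r'_lt R_alpha (S x) (ex_intro2 _ _ x Fx erefl).
have -> : C * R `^ alpha / r' = 2 * C / c * R `^ (- p).
  rewrite /r' R_beta powRN; field.
  by rewrite !gt_eqF ?powR_gt0.
have -> : R / R `^ theta^-1 = R `^ (1 - theta^-1).
  by rewrite powRB ?(gt_eqF R0) ?implybT// powRr1// ltW.
have Cc0 : 0 <= 2 * C / c by rewrite divr_ge0 ?mulr_ge0// ltW.
rewrite powRM// ?powR_ge0// -!powRrM.
have -> : (1 - theta^-1) * (a * (beta - theta * alpha) / (1 - theta)) = - p * a.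
  by rewrite /p; field; rewrite !gt_eqF.
rewrite [Ca * (_ * _)]mulrA; apply: le_trans.
apply: (@covering_number_transfer K X Y S (ball x R `&` F)
  (ball (S x) (C * R `^ alpha) `&` (S @` F)) (R `^ theta^-1) r').
  move=> _ [y [xy Fy] <-]; split; last by exists y.
  have xR : mdist x y < R by move: xy; rewrite ballEmdist.
  have /S_holder/andP[_ h] : mdist x y < delta by lra.
  rewrite ballEmdist /=; apply: le_lt_trans h _.
  by rewrite ltr_pM2l// gt0_ltr_powR// nnegrE ?mdist_ge0 ?ltW.
move=> y z [xy _] [xz _].
have /S_holder/andP[h _] := near_x y z xy xz.
rewrite /r' mulrA => /(le_lt_trans h).
have -> : 2 * (c / 2) = c by field.
rewrite ltr_pM2l// ltNge => Rb; rewrite ltNge; apply: contra Rb => Rb.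
rewrite mulrC powRrM; apply: ge0_ler_powR => //.
- exact: le_trans (ltW alpha0) alpha_beta.
- by rewrite nnegrE powR_ge0.
- by rewrite nnegrE mdist_ge0.
Qed.

(** With [L = ln (mdist x y)] and [L' = ln (mdist (S x) (S y))], both
    negative at small distances, closeness of [L / L'] to [1] puts [L']
    between [(1 + eps) L] and [(1 - eps) L], and exponentiating gives Hölder
    bounds with constants [1].  The tolerance [eps / 2] on the quotient
    suffices because [(1 + eps) (1 - eps / 2) >= 1] for [eps <= 1]. *)
Lemma quasi_lipschitz_bi_holder (K : realType) (X Y : metricType K)
    (S : X -> Y) (eps : K) :
  0 < eps < 1 -> quasi_lipschitz S -> locally_bi_holder (1 - eps) (1 + eps) S.
Proof.
move=> /andP[eps0 eps1] /(_ (eps / 2)) []; first by lra.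
move=> delta delta0 S_ql.
exists 1, 1, (Num.min delta 1); split => //; first by rewrite lt_min delta0/=.
move=> x y; rewrite lt_min => /andP[xy_delta xy1].
have [->|/eqP xy] := eqVneq x y.
  by rewrite !mdistxx !powR0 ?mulr0 ?lexx// gt_eqF//; lra.
have D0 : 0 < mdist x y by rewrite mdist_gt0; exact/eqP.
have := S_ql _ _ xy xy_delta.
set D := mdist x y in D0 xy1 *; set D' := mdist (S x) (S y).
have lnD : ln D < 0 by rewrite ln_lt0// D0.
rewrite ltr_distl => /andP[q_lo q_hi].
have q0 : 0 < ln D / ln D' by lra.
have lnD' : ln D' < 0 by move: q0; rewrite nmulr_rgt0// invr_lt0.
(* The convention [ln 0 = 0] makes [ln D' < 0] exclude [D' = 0]. *)
have D'0 : 0 < D'.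
  rewrite lt_neqAle mdist_ge0 andbT; apply: contraTneq lnD' => <-.
  by rewrite ln0// ltxx.
have lnE : ln D = ln D / ln D' * ln D' by rewrite divfK// lt_eqF.
rewrite !mul1r -[_ `^ _ <= D']ler_ln ?posrE ?powR_gt0//.
rewrite -[D' <= _]ler_ln ?posrE ?powR_gt0// !ln_powR.
move: lnE q_lo q_hi; set q := ln D / ln D' => -> q_lo q_hi.
have beta_q : 1 <= (1 + eps) * q by clear -eps0 eps1 q_lo; nra.
have alpha_q : (1 - eps) * q <= 1 by clear -eps0 eps1 q_hi; nra.
by rewrite ![_ * (q * _)]mulrA ler_neMl ?ler_niMl ?(ltW lnD').
Qed.

Theorem theorem4p11 (K : realType) (X Y : metricType K) (S : X -> Y)
    (F : set X) :
  doubling X -> doubling Y -> F !=set0 ->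
  (forall alpha beta : K,
     1 <= beta -> alpha <= 1 -> 0 < alpha ->
     locally_bi_holder alpha beta S ->
     attaining_thetas F !=set0 ->
     let theta0 := inf (attaining_thetas F) in
     (assouad_dim F / (beta - theta0 * alpha)%:E * (1 - theta0)%:E
        <= assouad_dim (S @` F))%E)
  /\
  (quasi_lipschitz S ->
   (exists2 theta : K, 0 < theta < 1 &
      assouad_spectrum theta F = assouad_dim F) ->
   (assouad_dim F <= assouad_dim (S @` F))%E).
Proof.
move=> _ _ _; split.
  move=> alpha beta beta1 alpha1 alpha0 S_holder [theta1 theta1_att] /=.
  set theta0 := inf _.
  have lb0 : lbound (attaining_thetas F) 0.
    by move=> theta [/andP[/ltW]].
  have theta0_lt1 : theta0 < 1.
    have [/andP[_ lt1] _] := theta1_att.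
    by apply: le_lt_trans lt1; apply: ge_inf => //; exists 0.
  have theta0_ge0 : 0 <= theta0 by apply: lb_le_inf => //; exists theta1.
  have den_gt0 t : 0 <= t < 1 -> 0 < beta - t * alpha by move=> /andP[? ?]; nra.
  have att_le theta : attaining_thetas F theta ->
      (assouad_dim F * ((1 - theta) / (beta - theta * alpha))%:E
         <= assouad_dim (S @` F))%E.
    move=> [theta01 <-]; apply: bi_holder_spectrum_le => //.
    by rewrite alpha0; lra.
  have den0 : 0 < beta - theta0 * alpha by apply: den_gt0; rewrite theta0_ge0.
  rewrite inver gt_eqF// -muleA -EFinM [X in X%:E]mulrC.
  apply/ereal_infP => _ [a a_adm <-].
  have {}att_le theta : attaining_thetas F theta ->
      (assouad_dim F * ((1 - theta) / (beta - theta * alpha))%:E <= a%:E)%E.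
    move=> /att_le/le_trans; apply; apply: ereal_inf_lbound.
    by exists a.
  case: (assouad_dim F) att_le => [d| |] att_le; last 1 first.
  - by rewrite gt0_mulNye ?leNye// lte_fin divr_gt0// subr_gt0.
  - have d_le theta : attaining_thetas F theta ->
        theta * (a * alpha - d) <= a * beta - d.
      move=> theta_att; have [/andP[t0 t1] _] := theta_att.
      have dt : 0 < beta - theta * alpha by rewrite den_gt0// ltW.
      have := att_le _ theta_att.
      rewrite -EFinM lee_fin mulrA ler_pdivrMr//; lra.
    rewrite -EFinM lee_fin mulrA ler_pdivrMr//.
    suff: theta0 * (a * alpha - d) <= a * beta - d by lra.
    (* For a negative slope [d_le] says that a fixed number is a lower bound of
       the attaining set, hence is at most [theta0]; otherwise the bound
       holds at [theta0] because it holds at [theta1 >= theta0]. *)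
    have [k_lt0|k_ge0] := ltP (a * alpha - d) 0.
      rewrite -ler_ndivrMr//; apply: lb_le_inf; first by exists theta1.
      by move=> theta theta_att; rewrite ler_ndivrMr// d_le.
    apply: le_trans (d_le _ theta1_att).
    by rewrite ler_wpM2r//; apply: ge_inf => //; exists 0.
  - have [/andP[t0 t1] _] := theta1_att.
    have := att_le _ theta1_att.
    by rewrite gt0_mulye// lte_fin divr_gt0 ?den_gt0 ?subr_gt0// ltW.
move=> S_ql [theta /andP[t0 t1] theta_att].
apply/ereal_infP => _ [a a_adm <-].
have d_le eps : 0 < eps < 1 ->
    (assouad_dim F *
       ((1 - theta) / ((1 + eps) - theta * (1 - eps)))%:E <= a%:E)%E.
  move=> eps01; rewrite -theta_att.
  apply: (@le_trans _ _ (assouad_dim (S @` F))).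
    apply: bi_holder_spectrum_le; rewrite ?t0//; first by lra.
    exact: quasi_lipschitz_bi_holder.
  by apply: ereal_inf_lbound; exists a.
have den0 eps : 0 < eps < 1 -> 0 < (1 + eps) - theta * (1 - eps).
  by move=> /andP[? ?]; nra.
case: (assouad_dim F) d_le => [d| |] d_le; last by rewrite leNye.
  rewrite lee_fin; apply/ler_addgt0Pr => e e0.
  (* [eps * k] bounds the excess over [a] of
     [a ((1 + eps) - theta (1 - eps)) / (1 - theta)]. *)
  set k := `|a| * (1 + theta) / (1 - theta).
  have k0 : 0 <= k by rewrite divr_ge0 ?mulr_ge0 ?subr_ge0//; lra.
  pose eps := Num.min (1 / 2) (e / (k + 1)).
  have eps01 : 0 < eps < 1.
    by rewrite /eps lt_min gt_min !divr_gt0//=; lra.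
  have eps_k : eps * (k + 1) <= e.
    by rewrite -ler_pdivlMr ?ge_min ?lexx ?orbT//; lra.
  have := d_le _ eps01; have := den0 _ eps01.
  rewrite -EFinM lee_fin mulrA => den_eps.
  rewrite ler_pdivrMr// => d_a.
  have num0 : 0 < 1 - theta by rewrite subr_gt0.
  have kE : k * (1 - theta) = `|a| * (1 + theta) by rewrite divfK ?gt_eqF.
  have [/andP[eps0 _] a_le] := (eps01, ler_norm a).
  have a_eps : a * (eps * (1 + theta)) <= eps * k * (1 - theta).
    by rewrite -mulrA kE mulrCA ler_pM2l// ler_wpM2r//; lra.
  have eps_e : eps * k * (1 - theta) <= e * (1 - theta).
    by rewrite ler_pM2r//; lra.
  rewrite -(ler_pM2r num0); lra.
have half : 0 < (2^-1 : K) < 1 by lra.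
have := d_le _ half.
by rewrite gt0_mulye// lte_fin divr_gt0 ?den0 ?subr_gt0.
Qed.
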